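(* For any $x,y\in\mathbf{H}_o$, $\langle x,y\rangle=\langle\Theta(x),\Theta(y)\rangle_{\mathbf{FQSym}}$.
   Context: $K$ is a commutative field. A rooted forest is a finite graph $F$ whose connected components are rooted trees; $V(F)$ is its vertex set. Edges are oriented from leaves to roots, and $v\twoheadrightarrow w$ means there is an oriented path from $v$ to $w$ (with $v\twoheadrightarrow v$). An ordered forest is a rooted forest with a total order on its vertices (up to isomorphism); if it has $n$ vertices, its vertex set is identified with $\{1,\ldots,n\}$ via the unique increasing bijection. $\mathbf{H}_o$ is the $K$-vector space with basis the ordered forests. The pairing on $\mathbf{H}_o$ is the bilinear form with $\langle F,G\rangle=|S(F,G)|$ for ordered forests $F,G$, where $S(F,G)$ is the set of bijections $f:V(F)\to V(G)$ such that for all $x,y\in V(F)$: $x\twoheadrightarrow y$ in $F$ implies $f(x)\ge f(y)$, and $f(x)\twoheadrightarrow f(y)$ in $G$ implies $x\ge y$. $\mathbf{FQSym}$ is the $K$-vector space with basis $\bigsqcup_{n\ge0}\mathfrak{S}_n$, with the bilinear form $\langle\sigma,\tau\rangle_{\mathbf{FQSym}}=\delta_{\sigma^{-1},\tau}$ for permutations $\sigma,\tau$ (zero if they have different sizes). For an ordered forest $F$ with $n$ vertices, $S_F$ is the set of $\sigma\in\mathfrak{S}_n$ such that for all $1\le i,j\le n$, $i\twoheadrightarrow j$ in $F$ implies $\sigma^{-1}(i)\ge\sigma^{-1}(j)$. $\Theta:\mathbf{H}_o\to\mathbf{FQSym}$ is the linear map with $\Theta(F)=\sum_{\sigma\in S_F}\sigma$.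 *)

(* Defs.v *)
From HB Require Import structures.
From mathcomp Require Import all_boot all_order all_algebra all_fingroup.
From mathcomp Require Import finmap.
From mathcomp Require Export monalg.

Set Implicit Arguments.
Unset Strict Implicit.
Unset Printing Implicit Defensive.

Import GRing.Theory.
Local Open Scope ring_scope.

(* {malg K[T]} is the K-vector space with basis T: finitely supported
   functions T -> K, where << t >> is the basis vector of t and x@_t the
   coordinate of x on it. *)
Section Extension.
Variables (K : fieldType) (T : choiceType).

Definition lin_ext (V : lmodType K) (f : T -> V) (x : {malg K[T]}) : V :=
  \sum_(t <- msupp x) x@_t *: f t.

Definition bilin_ext (b : T -> T -> K) (x y : {malg K[T]}) : K :=
  \sum_(s <- msupp x) \sum_(t <- msupp y) x@_s * y@_t * b s t.

Lemma lin_extEw (V : lmodType K) (f : T -> V) (x : {malg K[T]})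
    (d : {fset T}) :
  (msupp x `<=` d)%fset -> lin_ext f x = \sum_(t <- d) x@_t *: f t.
Proof.
move=> sxd; apply: (big_fset_incl _ sxd) => t _ /mcoeff_outdom ->.
by rewrite scale0r.
Qed.

Lemma lin_ext_is_linear (V : lmodType K) (f : T -> V) : linear (lin_ext f).
Proof.
move=> a x y; pose d := (msupp x `|` msupp y `|` msupp (a *: x + y))%fset.
have sx : (msupp x `<=` d)%fset by rewrite /d -fsetUA fsubsetUl.
have sy : (msupp y `<=` d)%fset.
  by apply: fsubset_trans (fsubsetUl _ _); rewrite fsubsetUr.
rewrite (lin_extEw f sx) (lin_extEw f sy) (@lin_extEw _ _ _ d) ?fsubsetUr //.
rewrite scaler_sumr -big_split /=; apply: eq_bigr => t _.
by rewrite mcoeffD mcoeffZ scalerDl scalerA.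
Qed.

HB.instance Definition _ (V : lmodType K) (f : T -> V) :=
  GRing.isLinear.Build K {malg K[T]} V _ (lin_ext f) (lin_ext_is_linear f).

Lemma lin_extU (V : lmodType K) (f : T -> V) (t : T) : lin_ext f << t >> = f t.
Proof. by rewrite (lin_extEw f msuppU_le) big_seq_fset1 mcoeffUU scale1r. Qed.

Lemma bilin_extEl (b : T -> T -> K) (x y : {malg K[T]}) :
  bilin_ext b x y = lin_ext (fun s => lin_ext (b s : T -> K^o) y : K^o) x.
Proof.
apply: eq_bigr => s _; rewrite [RHS]mulr_sumr; apply: eq_bigr => t _.
by rewrite -mulrA.
Qed.

Lemma bilin_extEr (b : T -> T -> K) (x y : {malg K[T]}) :
  bilin_ext b x y = lin_ext (fun t => lin_ext (b^~ t : T -> K^o) x : K^o) y.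
Proof.
rewrite /bilin_ext exchange_big; apply: eq_bigr => t _.
rewrite [RHS]mulr_sumr; apply: eq_bigr => s _.
by rewrite -mulrA mulrCA.
Qed.

Lemma bilin_ext_linearl (b : T -> T -> K) (y : {malg K[T]}) :
  linear (bilin_ext b ^~ y : {malg K[T]} -> K^o).
Proof. by move=> a x x'; rewrite !bilin_extEl linearP. Qed.

Lemma bilin_ext_linearr (b : T -> T -> K) (x : {malg K[T]}) :
  linear (bilin_ext b x : {malg K[T]} -> K^o).
Proof. by move=> a y y'; rewrite !bilin_extEr linearP. Qed.

Lemma bilin_extU (b : T -> T -> K) (s t : T) :
  bilin_ext b << s >> << t >> = b s t.
Proof. by rewrite bilin_extEl !lin_extU. Qed.

End Extension.

(* A rooted forest on 'I_n is encoded by its parent map p: the edges go from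
   each non-root vertex v to its parent w, where p v = Some w, and the roots
   are the v with p v = None.  Since a vertex has at most one outgoing edge,
   the graph is a disjoint union of rooted trees oriented towards their roots
   iff every vertex is joined to a root by an oriented path. *)
Section Forest.
Variable n : nat.

Definition edge (p : {ffun 'I_n -> option 'I_n}) : rel 'I_n :=
  [rel v w | p v == Some w].

Definition is_rooted_forest (p : {ffun 'I_n -> option 'I_n}) : bool :=
  [forall v, exists r, (p r == None) && connect (edge p) v r].

(* Isomorphism classes of ordered forests with n vertices are the rooted
   forests on 'I_n with its usual order (vertices are numbered from 0). *)
Record oforest := OForest {
  parent :> {ffun 'I_n -> option 'I_n};
  parentP : is_rooted_forest parent
}.

HB.instance Definition _ := [isSub for parent].
HB.instance Definition _ := [Finite of oforest by <:].

Definition opath (F : oforest) : rel 'I_n := connect (edge F).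

End Forest.

Notation ordered_forest := {n : nat & oforest n}.
Notation permutation := {n : nat & 'S_n}.

Notation Ho K := {malg K[ordered_forest]}.
Notation FQSym K := {malg K[permutation]}.

Definition S_pair (m n : nat) (F : oforest m) (G : oforest n) :
    {set {ffun 'I_m -> 'I_n}} :=
  [set f : {ffun 'I_m -> 'I_n} |
    [&& injectiveb f, [forall j, exists i, f i == j],
        [forall x, forall y, opath F x y ==> (f y <= f x)%N]
      & [forall x, forall y, opath G (f x) (f y) ==> (y <= x)%N]]].

Definition pairing (K : fieldType) : Ho K -> Ho K -> K :=
  bilin_ext (fun F G : ordered_forest => #|S_pair (tagged F) (tagged G)|%:R).

(* The equality test in {n : nat & 'S_n} is false when the sizes differ. *)
Definition FQSym_pairing (K : fieldType) : FQSym K -> FQSym K -> K :=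
  bilin_ext (fun s t : permutation =>
    (Tagged (fun n => 'S_n) ((tagged s)^-1)%g == t)%:R).

Definition S_forest (n : nat) (F : oforest n) : {set 'S_n} :=
  [set s : 'S_n |
    [forall i, forall j, opath F i j ==> ((s^-1)%g j <= (s^-1)%g i)%N]].

Definition Theta (K : fieldType) : Ho K -> FQSym K :=
  lin_ext (fun F : ordered_forest =>
    \sum_(s in S_forest (tagged F)) << Tagged (fun n => 'S_n) s >>).

(* Main.v *)
(** A permutation [s] lies in [S_F] exactly when its inverse, as a function,
    satisfies the first condition defining [S(F,G)], and [s^-1] lies in [S_G]
    exactly when it satisfies the second one.  Hence [S(F,G)] is in bijection
    with the [s] in [S_F] such that [s^-1] is in [S_G], which is what the
    pairing of the basis images [Theta F] and [Theta G] counts. *)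
Require Import Defs.
From mathcomp Require Import all_boot all_order all_algebra all_fingroup.

Set Implicit Arguments.
Unset Strict Implicit.
Unset Printing Implicit Defensive.

Import GRing.Theory.
Local Open Scope ring_scope.

Section BilinearExtension.
Variables (K : fieldType) (T : choiceType) (b : T -> T -> K).

(** The explicit coefficients fit both uses: [lin_ext f x] unfolds to such a sum, and a sum of basis
    vectors is one with all coefficients 1. *)
Lemma bilin_ext_suml (I : Type) (r : seq I) (P : pred I) (a : I -> K)
    (u : I -> {malg K[T]}) (y : {malg K[T]}) :
  bilin_ext b (\sum_(i <- r | P i) a i *: u i) y =
  \sum_(i <- r | P i) a i * bilin_ext b (u i) y.
Proof.
rewrite bilin_extEl linear_sum; apply: eq_bigr => i _.
by rewrite linearZ bilin_extEl.
Qed.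

Lemma bilin_ext_sumr (I : Type) (r : seq I) (P : pred I) (a : I -> K)
    (u : I -> {malg K[T]}) (x : {malg K[T]}) :
  bilin_ext b x (\sum_(i <- r | P i) a i *: u i) =
  \sum_(i <- r | P i) a i * bilin_ext b x (u i).
Proof.
rewrite bilin_extEr linear_sum; apply: eq_bigr => i _.
by rewrite linearZ bilin_extEr.
Qed.

Lemma bilin_ext_sumU (I J : finType) (A : {set I}) (B : {set J})
    (f : I -> T) (g : J -> T) :
  bilin_ext b (\sum_(i in A) << f i >>) (\sum_(j in B) << g j >>) =
  \sum_(i in A) \sum_(j in B) b (f i) (g j).
Proof.
under eq_bigr do rewrite -[<< _ >>]scale1r.
rewrite bilin_ext_suml; apply: eq_bigr => i _; rewrite mul1r.
under eq_bigr do rewrite -[<< _ >>]scale1r.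
rewrite bilin_ext_sumr; apply: eq_bigr => j _.
by rewrite mul1r bilin_extU.
Qed.

(** This reduces the comparison of two forms to basis elements: expanding the right side gives a
    double sum over the same supports, with the same coefficients. *)
Lemma bilin_ext_lin_ext (S : choiceType) (c : S -> S -> K)
    (f g : S -> {malg K[T]}) (x y : {malg K[S]}) :
  (forall s t, c s t = bilin_ext b (f s) (g t)) ->
  bilin_ext c x y = bilin_ext b (lin_ext f x) (lin_ext g y).
Proof.
move=> cE; rewrite [RHS]bilin_ext_suml; apply: eq_bigr => s _.
rewrite [bilin_ext b _ _]bilin_ext_sumr mulr_sumr; apply: eq_bigr => t _.
by rewrite cE mulrA.
Qed.

End BilinearExtension.

Lemma S_pair_eq0 (m n : nat) (F : oforest m) (G : oforest n) :
  m != n -> S_pair F G = set0.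
Proof.
move=> neq_mn; apply/setP=> f; rewrite !inE; apply/negP.
case/and4P=> /injectiveP f_inj /forallP f_surj _ _.
(* The image of [f] has [m] elements by injectivity and is all of ['I_n] by surjectivity. *)
case/eqP: neq_mn; rewrite -[m]card_ord -[n]card_ord -(card_codom f_inj).
apply: eq_card => j; rewrite [RHS]inE.
by have /existsP[i /eqP <-] := f_surj j; rewrite codom_f.
Qed.

Lemma S_pairE (n : nat) (F G : oforest n) :
  S_pair F G =
  [set [ffun i => (s^-1)%g i]
     | s : 'S_n in [set s in S_forest F | (s^-1)%g \in S_forest G]].
Proof.
apply/setP=> f; apply/idP/imsetP => [|[s + ->]]; rewrite !inE.
  case/and4P=> /injectiveP f_inj _ /'forall_forallP Ff /'forall_forallP Gf.
  exists (perm f_inj)^-1%g; last by apply/ffunP=> i; rewrite ffunE invgK permE.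
  rewrite !inE invgK; apply/andP; split; apply/'forall_forallP => i j.
    by rewrite !permE.
  (* Membership in [S_G] quantifies over vertices of [G], so the condition on [f] is read at the
     preimages of [i] and [j]. *)
  have := Gf ((perm f_inj)^-1%g i) ((perm f_inj)^-1%g j).
  by rewrite -!(permE f_inj) !permKV.
case/andP=> /'forall_forallP Fs /'forall_forallP Gs.
apply/and4P; split.
- by apply/injectiveP=> i j; rewrite !ffunE => /perm_inj.
- by apply/forallP=> j; apply/existsP; exists (s j); rewrite ffunE permK.
- by apply/'forall_forallP => i j; rewrite !ffunE.
- apply/'forall_forallP => i j; rewrite !ffunE.
  by have := Gs ((s^-1)%g i) ((s^-1)%g j); rewrite invgK !permKV.
Qed.

Lemma card_S_pair (n : nat) (F G : oforest n) :
  #|S_pair F G| = #|[set s in S_forest F | (s^-1)%g \in S_forest G]|.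
Proof.
rewrite S_pairE card_imset // => s t /ffunP st.
by apply: invg_inj; apply/permP=> i; have := st i; rewrite !ffunE.
Qed.

Theorem proposition11 (K : fieldType) (x y : Ho K) :
  pairing x y = FQSym_pairing (Theta x) (Theta y).
Proof.
apply: bilin_ext_lin_ext => -[m F] [n G] /=; rewrite bilin_ext_sumU /=.
have [eq_mn | neq_mn] := eqVneq m n; last first.
  rewrite S_pair_eq0 // cards0 big1 // => s _; rewrite big1 // => t _.
  (* For different sizes every term of the double sum vanishes as well, since the tags differ. *)
  by rewrite -tag_eqE /tag_eq /= (negPf neq_mn).
case: n / eq_mn G => G; rewrite card_S_pair -sum1dep_card natr_sum.
(* Both sides become sums over [S_F]; it remains to see that the inner sum over [t] in [S_G] is the
   0/1 indicator of [s^-1] lying in [S_G], only [t = s^-1] contributing. *)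
rewrite big_mkcondr; apply: eq_bigr => s _.
under eq_bigr do rewrite eq_Tagged /=.
case: ifPn => [sG | sNG].
  rewrite (bigD1 _ sG) /= eqxx big1 ?addr0 // => t /andP[_ ts].
  by rewrite eq_sym (negPf ts).
rewrite big1 // => t tG; case: eqP => // st.
by rewrite st tG in sNG.
Qed.
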